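(* Let $\vec{K}$ be a complete symmetric digraph on a finite or infinite (not necessarily countable) vertex set, let $r\ge 0$ be an integer, and let $\ell_1,\dots,\ell_r$ be positive integers. Let $c\colon E(\vec{K})\to\{1,\dots,r+1\}$ be an edge-colouring of $\vec{K}$ such that for every $i\in\{1,\dots,r\}$ there is no directed path of length $\ell_i$ all of whose edges have colour $i$. Then $V(\vec{K})$ can be partitioned into $\prod_{i=1}^{r}\ell_i$ (possibly empty) sets, each of which induces a complete symmetric digraph that is monochromatic in colour $r+1$; that is, for each set $U$ of the partition, every edge $(x,y)$ with $x,y\in U$, $x\ne y$, has colour $r+1$.
   Context: The complete symmetric digraph on a vertex set $V$ has as edges all ordered pairs $(x,y)$ of distinct elements of $V$ (so $(x,y)$ and $(y,x)$ are different edges and may receive different colours). A directed path of length $\ell$ is a sequence of $\ell+1$ distinct vertices $v_0v_1\dots v_\ell$ together with the $\ell$ edges $(v_0,v_1),\dots,(v_{\ell-1},v_\ell)$; its length is its number of edges. The empty product equals $1$. *)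

(* Defs.v *)
From mathcomp Require Import all_boot.
From mathcomp Require Import boolp classical_sets.

Set Implicit Arguments.
Unset Strict Implicit.
Unset Printing Implicit Defensive.

Local Open Scope classical_set_scope.

(* An edge-colouring of the complete symmetric digraph on V is given by a
   function c : V -> V -> C, with c x y the colour of the edge (x, y). The
   values c x x are irrelevant: no definition below depends on them. *)

(* The vertices of the path are v 0, ..., v l. *)
Definition mono_dipath (V C : Type) (c : V -> V -> C) (k : C) (l : nat)
    (v : 'I_l.+1 -> V) : Prop :=
  injective v /\
  forall j : 'I_l, c (v (widen_ord (leqnSn l) j)) (v (lift ord0 j)) = k.

Definition mono_complete (V C : Type) (c : V -> V -> C) (k : C)
    (U : set V) : Prop :=
  forall x y : V, U x -> U y -> x <> y -> c x y = k.

(* The library's [partition] also requires the parts to be nonempty. *)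
Definition weak_partition (V I : Type) (U : I -> set V) : Prop :=
  cover [set: I] U = [set: V] /\ trivIset [set: I] U.

(* Main.v *)
(** For a single colour this is the Gallai-Roy theorem, valid on infinite vertex
    sets because the path lengths are bounded: take a maximal acyclic set [A] of
    edges of that colour (Zorn) and colour a vertex by the length of the longest
    [A]-path ending at it.  An edge of [A] strictly raises this length; an edge
    [(x, y)] outside [A] closes a cycle by maximality, so [A] contains a path
    from [y] to [x] and the lengths differ again.  The product of the [r]
    vertex-colourings so obtained has classes without edges of the first [r]
    colours. *)
Require Import Defs.
From mathcomp Require Import all_boot.
From mathcomp Require Import boolp classical_sets.
From Stdlib Require Import Relations.

Local Open Scope classical_set_scope.

Definition reach (V : Type) (A : set (V * V)) : relation V :=
  clos_trans V (fun x y => A (x, y)).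

(** [clos_trans] is not reflexive, so only closed walks of positive length, loops included, are
    excluded. *)
Definition acyclic (V : Type) (A : set (V * V)) : Prop :=
  forall x, ~ reach V A x x.

Lemma reach_sub (V : Type) (A B : set (V * V)) (x y : V) :
  A `<=` B -> reach V A x y -> reach V B x y.
Proof.
move=> AB; elim=> [a b /AB Bab|a b d _ IHab _ IHbd]; first exact: t_step.
exact: t_trans IHab IHbd.
Qed.

(** A walk has finitely many edges, so one member of the chain contains them all; this gives the
    upper bounds for Zorn. *)
Lemma reach_bigcup (V : Type) (F : set (set (V * V))) (x y : V) :
  total_on F subset -> reach V (\bigcup_(X in F) X) x y ->
  exists2 X, F X & reach V X x y.
Proof.
move=> Ftot; elim=> [a b [X FX Xab]|a b d _ [X FX Xab] _ [Y FY Ybd]].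
  by exists X => //; exact: t_step.
have [XY|YX] := Ftot X Y FX FY.
  by exists Y => //; apply: t_trans Ybd; exact: reach_sub Xab.
by exists X => //; apply: (t_trans _ _ _ _ _ Xab); exact: reach_sub Ybd.
Qed.

(** Cut a walk at its first and last use of [(u, v)]: the outer pieces lie in [A]. *)
Lemma reach_setU1 (V : Type) (A : set (V * V)) (u v x y : V) :
  reach V (A `|` [set (u, v)]) x y ->
  reach V A x y \/
  (x = u \/ reach V A x u) /\ (v = y \/ reach V A v y).
Proof.
elim=> [a b [Aab|[-> ->]]|a b d _ IHab _ IHbd].
- by left; exact: t_step.
- by right; split; left.
case: IHab => [ab|[au vb]]; case: IHbd => [bd|[bu vd]].
- by left; exact: t_trans ab bd.
- right; split=> //; right; case: bu => [<-//|bu]; exact: t_trans ab bu.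
- right; split=> //; right; case: vb => [->//|vb]; exact: t_trans vb bd.
- by right; split.
Qed.

Lemma exists_maximal_acyclic (V : Type) (E : set (V * V)) :
  exists A : set (V * V), [/\ A `<=` E, acyclic V A &
    forall u v, u <> v -> E (u, v) -> A (u, v) \/ reach V A v u].
Proof.
have [|A [[AE Aacy] Amax]] :=
    @Zorn_bigcup _ [set A : set (V * V) | A `<=` E /\ acyclic V A].
  move=> F FP Ftot; split=> [e [X /FP [XE _] /XE //]|x xx].
  have [X /FP [_ Xacy]] := reach_bigcup V F x x Ftot xx.
  exact: Xacy.
exists A; split=> // u v uv Euv; apply: contrapT => /not_orP [nAuv nvu].
apply: (Amax (A `|` [set (u, v)])).
  by split=> [e Ae|sub]; [left | apply: nAuv; apply: sub; right].
split=> [e [/AE //|-> //]|x xx].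
(* A closed walk through the new edge leaves a walk in [A] from [v] back to [u], or else [u = v]. *)
have [/(Aacy x) //|[xu vx]] := reach_setU1 V A u v x x xx.
case: xu vx => [->|xu] [vx|vx].
- exact: uv.
- exact: nvu.
- by apply: nvu; rewrite vx.
- by apply: nvu; exact: t_trans vx xu.
Qed.

(** Only [f 0], ..., [f n] matter. Vertices may repeat, so appending an edge needs no distinctness
    check. *)
Definition walk_to (V : Type) (A : set (V * V)) (n : nat) (x : V) : Prop :=
  exists2 f : nat -> V, f n = x & forall i, i < n -> A (f i, f i.+1).

Lemma walk_to_step (V : Type) (A : set (V * V)) (n : nat) (x y : V) :
  walk_to V A n x -> A (x, y) -> walk_to V A n.+1 y.
Proof.
move=> [f fn fA] Axy; exists (fun i => if i <= n then f i else y).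
  by rewrite ltnn.
move=> i; rewrite ltnS; case: (ltngtP i n) => [lt_in _|//|-> _]; last first.
  by rewrite fn.
exact: fA.
Qed.

Lemma walk_reach (V : Type) (A : set (V * V)) (n : nat) (f : nat -> V)
    (i j : nat) :
  (forall k, k < n -> A (f k, f k.+1)) -> i < j -> j <= n ->
  reach V A (f i) (f j).
Proof.
move=> fA; elim: j => // j IHj; rewrite ltnS leq_eqVlt.
move=> /predU1P [->|lt_ij] jn.
  exact/t_step/fA.
apply: (t_trans _ _ _ (f j)); first by apply: IHj => //; exact: ltnW.
exact/t_step/fA.
Qed.

(* Acyclicity makes every walk in [A] a path. *)
Lemma walk_to_bounded (V : Type) (E A : set (V * V)) (l n : nat) (x : V) :
  A `<=` E -> acyclic V A ->
  (~ exists v : 'I_l.+1 -> V, injective v /\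
       forall j : 'I_l, E (v (widen_ord (leqnSn l) j), v (lift ord0 j))) ->
  walk_to V A n x -> n < l.
Proof.
move=> AE Aacy noE [f _ fA]; rewrite ltnNge; apply/negP => le_ln; apply: noE.
have len (i : 'I_l.+1) : i <= n.
  by apply: leq_trans le_ln; rewrite -ltnS ltn_ord.
exists (fun i => f i); split=> [i j fij|j]; last first.
  by apply: AE; apply: fA; exact: leq_trans (ltn_ord j) le_ln.
apply: val_inj; case: (ltngtP i j) => // ltij.
  by have := walk_reach V A n f i j fA ltij (len j); rewrite fij => /(Aacy (f j)).
by have := walk_reach V A n f j i fA ltij (len i); rewrite fij => /(Aacy (f j)).
Qed.

Theorem gallai_roy (V : Type) (E : set (V * V)) (l : nat) :
  (~ exists v : 'I_l.+1 -> V, injective v /\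
       forall j : 'I_l, E (v (widen_ord (leqnSn l) j), v (lift ord0 j))) ->
  exists f : V -> 'I_l, forall x y, x <> y -> E (x, y) -> f x <> f y.
Proof.
move=> noE; have [A [AE Aacy Amax]] := exists_maximal_acyclic V E.
have bound n x : walk_to V A n x -> n < l by exact: walk_to_bounded AE Aacy noE.
have /choice [f fP] : forall x, exists k : 'I_l,
    walk_to V A k x /\ forall n, walk_to V A n x -> n <= k.
  move=> x; have w0 : exists n, `[< walk_to V A n x >].
    (* The constant walk of length 0, so that the maximum is taken over a nonempty set. *)
    by exists 0; apply/asboolP; exists (fun=> x).
  have wl n : `[< walk_to V A n x >] -> n <= l by move=> /asboolP /bound /ltnW.
  case: (ex_maxnP w0 wl) => k /asboolP wk kmax.
  by exists (Ordinal (bound k x wk)); split=> // n /asboolP /kmax.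
have f_lt x y : reach V A x y -> f x < f y.
  elim=> [a b Aab|a b d _ ab _]; last exact: ltn_trans.
  by apply: (fP b).2; exact: walk_to_step (fP a).1 Aab.
exists f => x y xy Exy fxy; case: (Amax x y xy Exy) => [Axy|/f_lt].
  by have := f_lt x y (t_step _ _ _ _ Axy); rewrite fxy ltnn.
by rewrite fxy ltnn.
Qed.

Lemma weak_partition_fibers (V I : Type) (f : V -> I) :
  weak_partition (fun i => [set x | f x = i]).
Proof.
split; first by apply/seteqP; split=> // x _; exists (f x).
by move=> i j _ _ [x [/= <- <-]].
Qed.

Lemma card_dffun_ord (r : nat) (l : 'I_r -> nat) :
  #|{dffun forall i : 'I_r, 'I_(l i)}| = \prod_(i < r) l i.
Proof.
rewrite card_dep_ffun foldrE big_map big_enum /=.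
by apply: eq_bigr => i _; rewrite card_ord.
Qed.

(* The colours 1, ..., r + 1 are the elements 0, ..., r of 'I_r.+1: the colour
   of index i : 'I_r is [widen_ord (leqnSn r) i], the last one is [ord_max]. *)
Theorem theorem1p3 (V : Type) (r : nat) (l : 'I_r -> nat)
    (l_gt0 : forall i : 'I_r, 0 < l i)
    (c : V -> V -> 'I_r.+1)
    (no_path : forall i : 'I_r,
       ~ exists v : 'I_(l i).+1 -> V,
           mono_dipath c (widen_ord (leqnSn r) i) v) :
  exists U : 'I_(\prod_(i < r) l i) -> set V,
    weak_partition U /\ forall j, mono_complete c ord_max (U j).
Proof.
have ex_f i : exists f : V -> 'I_(l i), forall x y,
    x <> y -> c x y = widen_ord (leqnSn r) i -> f x <> f y.
  exact: (gallai_roy V [set e | c e.1 e.2 = widen_ord (leqnSn r) i]).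
pose f i := projT1 (cid (ex_f i)).
have fP i : forall x y,
    x <> y -> c x y = widen_ord (leqnSn r) i -> f i x <> f i y.
  exact: projT2 (cid (ex_f i)).
(* A dependent function, since the range ['I_(l i)] varies with the colour; [enum_rank] then numbers
   these tuples. *)
pose g x : {dffun forall i : 'I_r, 'I_(l i)} := [ffun i => f i x].
pose h x := cast_ord (card_dffun_ord r l) (enum_rank (g x)).
exists (fun j => [set x | h x = j]); split; first exact: weak_partition_fibers.
move=> j x y <- hyx xy; apply: contrapT => c_neq.
(* A colour other than [ord_max] is one of the first [r], and its own coordinate of [g] separates
   [x] from [y]. *)
have c_lt : c x y < r.
  rewrite ltn_neqAle -ltnS ltn_ord andbT.
  by apply/eqP => c_eq; apply: c_neq; exact: val_inj.
apply: (fP (Ordinal c_lt) x y xy); first exact: val_inj.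
have /ffunP /(_ (Ordinal c_lt)) : g x = g y.
  by apply: enum_rank_inj; exact: cast_ord_inj (esym hyx).
by rewrite !ffunE.
Qed.
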